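(* Let $T$ be a compact metric space endowed with a Borel probability measure $\mathbb{P}$ such that every ball in $T$ has positive probability. Let $\varphi:\mathbb{R}^n\times T\to\mathbb{R}$ be continuous, such that for each $t\in T$ the function $h_t:=\varphi(\cdot,t):\mathbb{R}^n\to\mathbb{R}$ is convex and differentiable and the derivative $(x,t)\mapsto\nabla_x\varphi(x,t)=\nabla h_t(x)$ is continuous on $\mathbb{R}^n\times T$. Consider the problem $(P)$: $\min\{f(x)=g(x)-h(x):x\in\mathbb{R}^n\}$, with finite optimal value, where $g:\mathbb{R}^n\to\mathbb{R}\cup\{+\infty\}$ is lower semicontinuous and convex and $h(x)=\max_{t\in T}\varphi(x,t)$. Let $\{x^k\}$ be a sequence generated by Algorithm 3 (described in the context), and assume that almost surely the sequence $\{x^k\}$ is bounded. Then $\{f(x^k)\}$ is a decreasing sequence and, almost surely, any limit point of $\{x^k\}$ is a directional stationary point of $(P)$.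
   Context: For $x\in\mathbb{R}^n$, $M(x)=\{t\in T:h_t(x)=h(x)\}$. Algorithm 3. Start with $x^0\in\mathbb{R}^n$. For $k=0,1,\dots$: 1. Pick $t_k\in M(x^k)$ and compute a solution $x^{k+1}_{t_k}$ of the convex program $\min\{g(x)-\langle\nabla h_{t_k}(x^k),x\rangle:x\in\mathbb{R}^n\}$. 2. (Randomized step) Randomly select $\xi_k\in T$ with distribution $\mathbb{P}$, independently from the previous iterations, and compute a solution $x^{k+1}_{\xi_k}$ of $\min\{g(x)-\langle\nabla h_{\xi_k}(x^k),x\rangle:x\in\mathbb{R}^n\}$. 3. Set $x^{k+1}:=x^{k+1}_t$ for an index $t\in\{t_k,\xi_k\}$ minimizing $g(x^{k+1}_t)-\langle\nabla h_t(x^k),x^{k+1}_t-x^k\rangle-h_t(x^k)$ over $\{t_k,\xi_k\}$. All subproblems are assumed solvable, so that an infinite sequence is generated. ''Decreasing'' means $f(x^{k+1})\le f(x^k)$. A directional stationary point of $(P)$ is a point $x$ with $f(x)$ finite such that $f'(x,d)=g'(x,d)-h'(x,d)\ge0$ for all $d\in\mathbb{R}^n$, where $\psi'(x,d)=\lim_{s\to0^+}\frac{\psi(x+sd)-\psi(x)}{s}$. *)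

(* Defs.v *)
From HB Require Import structures.
From mathcomp Require Import all_boot all_order all_algebra.
From mathcomp Require Import all_classical all_reals all_analysis.

Set Implicit Arguments.
Unset Strict Implicit.
Unset Printing Implicit Defensive.

Import Order.TTheory GRing.Theory Num.Theory.
Import numFieldNormedType.Exports.

Local Open Scope classical_set_scope.
Local Open Scope ring_scope.

(* The library equips only pointed types with a generated sigma-algebra; a
   metric space carrying a probability measure is nonempty, so the choice of a
   point is harmless. *)
#[short(type="pmetricType")]
HB.structure Definition PointedMetric (K : numDomainType) :=
  { M of Metric K M & isPointed M }.

Notation borel T := (g_sigma_algebraType (@open T)).

Section dc_program.
Context {R : realType} {n : nat} {T : Type}.
Implicit Types (x y d : 'rV[R]_n) (phi : 'rV[R]_n -> T -> R)
  (g psi : 'rV[R]_n -> \bar R) (t s : T).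

Definition dot x y : R := \sum_i x 0 i * y 0 i.

Definition grad (u : 'rV[R]_n -> R) x : 'rV[R]_n :=
  \row_i 'D_(delta_mx 0 i) u x.

(* At weights 0 and 1 the convention 0 * +oo = 0 makes the inequality trivial;
   for a function that never takes the value -oo the right-hand side is never
   of the form +oo - oo. *)
Definition econvex g := forall x y (a : R), 0 <= a -> a <= 1 ->
  (g (a *: x + (1 - a) *: y)%R <= a%:E * g x + (1 - a)%:E * g y)%E.

(* The supremum is a maximum when T is compact, nonempty, and phi x is
   continuous. *)
Definition maxfun phi x : R := sup (range (phi x)).

Definition active phi x : set T := [set t | phi x t = maxfun phi x].

Definition objective g phi x : \bar R := (g x - (maxfun phi x)%:E)%E.

Definition minimizer psi y := forall z, (psi y <= psi z)%E.

Definition subproblem g phi x t y : \bar R :=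
  (g y - (dot (grad (phi ^~ t) x) y)%:E)%E.

Definition model g phi x t y : \bar R :=
  (g y - (dot (grad (phi ^~ t) x) (y - x)%R)%:E - (phi x t)%:E)%E.

(* One iteration from x to x': s is the random index, and sol s' is the
   computed solution of the subproblem with index s'; only its values at t and
   s matter. *)
Definition iteration g phi x t s (sol : T -> 'rV[R]_n) x' :=
  [/\ active phi x t,
      minimizer (subproblem g phi x t) (sol t),
      minimizer (subproblem g phi x s) (sol s) &
      exists2 r, [set t; s] r &
        (forall r', [set t; s] r' ->
          (model g phi x r (sol r) <= model g phi x r' (sol r'))%E) /\
        x' = sol r].

Definition is_dirderiv psi x d (l : \bar R) :=
  ((e^-1)%:E * (psi (x + e *: d)%R - psi x))%E @[e --> (0 : R)^'+] --> l.

Definition dir_stationary g phi x :=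
  objective g phi x \is a fin_num /\
  forall d, exists (a : \bar R) (b : R),
    [/\ is_dirderiv g x d a,
        is_dirderiv (EFin \o maxfun phi) x d b%:E,
        is_dirderiv (objective g phi) x d (a - b%:E)%E &
        (0 <= a - b%:E)%E].

End dc_program.

Section randomized_algorithm.
Context {R : realType} {n : nat} {T : pmetricType R} {d : measure_display}
  {Omega : measurableType d}.

(* sigma(x_0, ..., x_k, xi_0, ..., xi_(k-1)): what is known when iteration k
   starts. *)
Definition history (x : nat -> Omega -> 'rV[R]_n) (xi : nat -> Omega -> T)
    (k : nat) : set (set Omega) :=
  <<s [set A |
    (exists2 j, (j <= k)%N &
       g_sigma_algebra_preimage (x j : Omega -> borel 'rV[R]_n) A) \/
    (exists2 j, (j < k)%N &
       g_sigma_algebra_preimage (xi j : Omega -> borel T) A)] >>.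

Record randomized_run (g : 'rV[R]_n -> \bar R) (phi : 'rV[R]_n -> T -> R)
    (P : probability (borel T) R) (Q : probability Omega R) (x0 : 'rV[R]_n)
    (x : nat -> Omega -> 'rV[R]_n) (t xi : nat -> Omega -> T)
    (sol : nat -> Omega -> T -> 'rV[R]_n) : Prop := {
  run_measurable_x : forall k,
    measurable_fun setT (x k : Omega -> borel 'rV[R]_n) ;
  run_measurable_xi : forall k,
    measurable_fun setT (xi k : Omega -> borel T) ;
  run_distribution : forall k (B : set (borel T)), measurable B ->
    Q (xi k @^-1` B) = P B ;
  run_independence : forall k (A : set Omega) (B : set (borel T)),
    history x xi k A -> measurable B ->
    Q (A `&` xi k @^-1` B) = (Q A * Q (xi k @^-1` B))%E ;
  run_start : forall w, x 0%N w = x0 ;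
  run_iteration : forall k w,
    iteration g phi (x k w) (t k w) (xi k w) (sol k w) (x k.+1 w)
}.

End randomized_algorithm.

(* Main.v *)
Require Import Defs.
From mathcomp Require Import all_boot all_order all_algebra.
From mathcomp Require Import all_classical all_reals all_analysis.
From mathcomp Require Import lra ring.

(** Write [f] for the objective and [h] for the maximum function. Minimality of
    the chosen model value, and the fact that a convex function lies above its
    linearizations, give for every [z] and every index [s] among the two tried
    at step [k]
      [f (x k.+1) <= g z - lin phi (x k) s z],
    where [lin phi x s] is the linearization at [x] of the [s]-th function
    ([iteration_le]). The active index with [z = x k] gives descent.

    Let [y] be a limit point. If, for every index [s], some iterate near [y] is
    paired with a random index near [s], the inequality passes to the limit
    ([limit_subgradient]): since [f y] is at most every [f (x k)], by lower
    semicontinuity and descent,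
      [f y <= g z - lin phi y s z] for all [s] and [z].
    Taking [z = y + e *: v] and letting [e] tend to 0, uniformly in [s] because
    the index space is compact, shows that the derivative of [f] at [y] in the
    direction [v] is nonnegative ([stationary_of_subgradients]). It exists
    because both [g] and [h] are convex and [h] is finite.

    The pairing holds almost surely. The random index is independent of the
    past and falls in a given ball with positive probability, so if infinitely
    many iterates visit a given open set, almost surely one of these visits is
    paired with an index in the ball ([conditional_Borel_Cantelli]). Countably
    many pairs of balls suffice ([ae_recurrence]). *)

Set Implicit Arguments.
Unset Strict Implicit.
Unset Printing Implicit Defensive.

Import Order.TTheory GRing.Theory Num.Theory.
Import numFieldNormedType.Exports.

Local Open Scope classical_set_scope.
Local Open Scope ring_scope.

(** * The inner product *)

Section dot.
Context {R : realType} {n : nat}.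
Implicit Types (a b c : 'rV[R]_n).

Lemma dotB a b c : dot a (b - c) = dot a b - dot a c.
Proof. by rewrite /dot -sumrB; apply: eq_bigr => i _; rewrite !mxE mulrBr. Qed.

Lemma dotZ a b (k : R) : dot a (k *: b) = k * dot a b.
Proof.
by rewrite /dot mulr_sumr; apply: eq_bigr => i _; rewrite mxE mulrCA.
Qed.

Lemma dot0 a : dot a 0 = 0.
Proof. by rewrite /dot big1// => i _; rewrite !mxE mulr0. Qed.

Lemma dot_cvg {I : Type} {F : set_system I} {FF : Filter F}
    (f g : I -> 'rV[R]_n) a b :
  f i @[i --> F] --> a -> g i @[i --> F] --> b ->
  dot (f i) (g i) @[i --> F] --> dot a b.
Proof.
move=> fa gb; apply: cvg_big => // [|i _]; first exact: add_continuous.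
apply: cvgM.
  exact: (cvg_comp _ _ fa (@coord_continuous _ _ _ 0 i a)).
exact: (cvg_comp _ _ gb (@coord_continuous _ _ _ 0 i b)).
Qed.

End dot.

(** * Convex functions and their directional derivatives *)

Section convex.
Context {R : realType} {n : nat}.
Implicit Types (x y z v : 'rV[R]_n) (u : 'rV[R]_n -> R)
  (psi : 'rV[R]_n -> \bar R).

Lemma convex_functionW u : convex_function [set: 'rV[R]_n] u ->
  forall x y (a : R), 0 <= a -> a <= 1 ->
  u (a *: x + (1 - a) *: y) <= a * u x + (1 - a) * u y.
Proof.
move=> cu x y a a0 a1.
have := cu (Itv01 a0 a1) x y; rewrite !inE => /(_ I I); exact.
Qed.

Lemma dotE u x v : differentiable u x -> dot (grad u x) v = 'D_v u x.
Proof.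
move=> du; rewrite deriveE// [in RHS](row_sum_delta v) linear_sum/=.
by apply: eq_bigr => i _; rewrite linearZ/= mxE deriveE// mulrC.
Qed.

(** A difference quotient of a convex function over a step at most 1 is bounded
    by the increment over the whole segment; the gradient is the limit of these
    quotients. *)
Lemma gradient_le u x z : convex_function [set: 'rV[R]_n] u ->
  differentiable u x -> u x + dot (grad u x) (z - x) <= u z.
Proof.
move=> cu du; rewrite dotE// -lerBrDl.
have dv : derivable u x (z - x) by exact: diff_derivable.
have qcvg : (h^-1 *: ((u \o shift x) (h *: (z - x)) - u x) @[h --> 0^'+]) -->
    'D_(z - x) u x.
  exact: cvg_dnbhs_at_right dv.
rewrite -(cvg_lim _ qcvg)//; apply: limr_le; first by apply: cvgP qcvg.
near=> h.
have h0 : 0 < h by near: h; exact: nbhs_right_gt.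
have h1 : h <= 1 by near: h; apply: nbhs_right_le.
have := convex_functionW cu z x (ltW h0) h1.
have -> : h *: z + (1 - h) *: x = h *: (z - x) + x.
  by rewrite scalerBr scalerBl scale1r addrA addrAC.
move=> H; rewrite -ler_pdivlMl ?invr_gt0// invrK /=.
rewrite lerBlDr; apply: le_trans H _; lra.
Unshelve. all: by end_near. Qed.

Definition diffquot psi x v (e : R) : \bar R :=
  ((e^-1)%:E * (psi (x + e *: v)%R - psi x))%E.

(** For [e1 <= e2] the point [x + e1 *: v] is the convex combination of
    [x + e2 *: v] and [x] with weights [e1 / e2] and [1 - e1 / e2]. *)
Lemma diffquot_mono psi x v : econvex psi -> (forall y, psi y <> -oo%E) ->
  psi x \is a fin_num -> forall e1 e2 : R, 0 < e1 -> e1 <= e2 ->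
  (diffquot psi x v e1 <= diffquot psi x v e2)%E.
Proof.
move=> cpsi pN fx e1 e2 e10 e12; have e20 := lt_le_trans e10 e12.
rewrite /diffquot; case E : (psi x) fx => [r| |] // _.
case E2 : (psi (x + e2 *: v)) => [b| |]; last 2 first.
- by rewrite addye// gt0_muley ?leey// lte_fin invr_gt0.
- by have := pN _ E2.
have a0 : 0 <= e1 / e2 by rewrite divr_ge0// ltW.
have a1 : e1 / e2 <= 1 by rewrite ler_pdivrMr ?mul1r.
have := cpsi (x + e2 *: v) x _ a0 a1.
have -> : (e1 / e2) *: (x + e2 *: v) + (1 - e1 / e2) *: x = x + e1 *: v.
  rewrite scalerDr scalerA mulfVK ?gt_eqF// scalerBl scale1r.
  by rewrite addrAC addrCA subrr addr0.
rewrite E E2; case E1 : (psi (x + e1 *: v)) => [c| |]; last 2 first.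
- by rewrite leye_eq.
- by have := pN _ E1.
rewrite -!EFinM -!EFinD -?EFinM !lee_fin => H.
rewrite ler_pdivrMl//; apply: le_trans (_ : e1 / e2 * (b - r) <= _); first lra.
by rewrite mulrA.
Qed.

(** One-sided directional derivatives of a convex function exist in the extended
    reals, as monotone limits; the value +oo occurs when [v] points out of the
    domain. *)
Lemma diffquot_cvg psi x v : econvex psi -> (forall y, psi y <> -oo%E) ->
  psi x \is a fin_num ->
  is_dirderiv psi x v (ereal_inf (diffquot psi x v @` [set` `]0, +oo[])).
Proof.
move=> cpsi pN fx; apply: nondecreasing_at_right_cvge => //.
move=> a b; rewrite !in_itv/= !andbT => a0 b0 ab.
exact: diffquot_mono.
Qed.

(** For a real-valued convex function the limit is finite: the quotient at 1
    bounds it from above, and, [x] lying between [x + e *: v] and [x - v], the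
    backward difference [u x - u (x - v)] bounds every quotient from below. *)
Lemma convex_real_dirderiv u x v : econvex (EFin \o u) ->
  exists b : R, is_dirderiv (EFin \o u) x v b%:E.
Proof.
move=> cu.
have D := @diffquot_cvg (EFin \o u) x v cu (fun _ => ltac:(by [])) (erefl _).
set l := ereal_inf _ in D.
have lub : (l <= diffquot (EFin \o u) x v 1)%E.
  by apply: ereal_inf_lbound; exists 1 => //=; rewrite in_itv/= ltr01.
have llb : ((u x - u (x - v))%:E <= l)%E.
  apply: le_ereal_inf_tmp => _ [e + <-]; rewrite /= in_itv/= andbT => e0.
  rewrite /diffquot /= -EFinB -EFinM lee_fin ler_pdivlMl//.
  have e1 : 0 < 1 + e by rewrite addr_gt0.
  have := cu (x + e *: v) (x - v) (1 + e)^-1.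
  rewrite invr_ge0 (ltW e1) invf_le1// lerDl (ltW e0) => /(_ isT isT).
  have -> : (1 + e)^-1 *: (x + e *: v) + (1 - (1 + e)^-1) *: (x - v) = x.
    have -> : 1 - (1 + e)^-1 = (1 + e)^-1 * e by field; rewrite gt_eqF.
    rewrite -scalerA -scalerDr scalerBr addrACA subrr addr0.
    rewrite -[X in X + e *: x]scale1r -scalerDl scalerA.
    by rewrite mulVf ?scale1r ?gt_eqF.
  rewrite /= -!EFinM -EFinD lee_fin => H.
  rewrite -(ler_pM2l (_ : 0 < (1 + e)^-1)) ?invr_gt0//.
  have I : (1 + e)^-1 * (1 + e) = 1 by rewrite mulVf ?gt_eqF.
  have J : (1 + e)^-1 * e = 1 - (1 + e)^-1.
    by move: I; rewrite mulrDr mulr1 => I; lra.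
  rewrite mulrA J; lra.
move: D llb lub; case: l => [b| |] D; first by exists b.
- by rewrite leye_eq.
- by rewrite leeNy_eq.
Qed.

End convex.

(** * The maximum function *)

Section maxfun.
Context {R : realType} {n : nat} {T : ptopologicalType}.
Variable phi : 'rV[R]_n -> T -> R.
Hypothesis cT : compact [set: T].
Hypothesis cphi : continuous (fun p : 'rV[R]_n * T => phi p.1 p.2).
Implicit Types (x y z v : 'rV[R]_n) (s : T).

Lemma has_ubound_phi x : has_ubound (range (phi x)).
Proof.
have cx : {within [set: T], continuous (phi x)}.
  apply: continuous_subspaceT => s.
  apply: (@continuous_comp _ _ _ (fun s' => (x, s'))
    (fun p => phi p.1 p.2) s); last exact: cphi.
  apply: (@cvg_pair _ _ _ (nbhs s) (nbhs x) (nbhs s)).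
    exact: cvg_cst.
  exact: cvg_id.
have [|c _ cmax] := compact_EVT_max _ cT cx; first by exists point.
by exists (phi x c) => _ [s _ <-]; apply: cmax; rewrite inE.
Qed.

Lemma le_maxfun x s : phi x s <= maxfun phi x.
Proof. by apply: ub_le_sup; [exact: has_ubound_phi|exists s]. Qed.

Lemma maxfun_le x (M : R) : (forall s, phi x s <= M) -> maxfun phi x <= M.
Proof.
move=> H; apply: ge_sup; first by exists (phi x point), point.
by move=> _ [s _ <-].
Qed.

Lemma maxfun_econvex : (forall s, convex_function [set: 'rV[R]_n] (phi ^~ s)) ->
  econvex (EFin \o maxfun phi).
Proof.
move=> cc x y a a0 a1; rewrite /= -!EFinM -EFinD lee_fin.
apply: maxfun_le => s; apply: le_trans (convex_functionW (cc s) x y a0 a1) _.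
by apply: lerD; apply: ler_wpM2l; rewrite ?subr_ge0// le_maxfun.
Qed.

(** The inequality [phi x s < M] persists near [(x, s)] for each [s];
    compactness makes the neighbourhood of [x] uniform in [s]. *)
Lemma maxfun_usc x (M : R) : maxfun phi x < M ->
  \forall y \near x, maxfun phi y <= M.
Proof.
move=> hM; move/compact_near_coveringP : cT.
move=> /(_ _ (nbhs x) (fun y s => phi y s < M)).
have H : forall s, [set: T] s -> \forall s' \near s & y \near x, phi y s' < M.
  move=> s _; have /cvgr_lt /(_ M) := @cphi (x, s).
  move=> /(_ (le_lt_trans (le_maxfun _ _) hM)).
  case=> -[U V]/= [Ux Vs] UV; exists (V, U) => // -[s' y]/= [Vs' Uy].
  exact: (UV (y, s')).
move=> /(_ _ H); apply: filterS => y Hy; apply: maxfun_le => s.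
by apply/ltW/Hy.
Qed.

End maxfun.

(** * Directional stationarity *)

Definition lin {R : realType} {n : nat} {T : Type} (phi : 'rV[R]_n -> T -> R)
  (x : 'rV[R]_n) (s : T) (z : 'rV[R]_n) : R :=
  phi x s + dot (grad (phi ^~ s) x) (z - x).

Section stationarity.
Context {R : realType} {n : nat} {T : ptopologicalType}.
Variable phi : 'rV[R]_n -> T -> R.
Hypothesis cT : compact [set: T].
Hypothesis cphi : continuous (fun p : 'rV[R]_n * T => phi p.1 p.2).
Hypothesis convphi : forall s, convex_function [set: 'rV[R]_n] (phi ^~ s).
Hypothesis dphi : forall s y, differentiable (phi ^~ s) y.
Hypothesis cgrad : continuous (fun p : 'rV[R]_n * T => grad (phi ^~ p.2) p.1).
Implicit Types (x y z v : 'rV[R]_n) (s : T).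

(** Continuity of the gradient, made uniform in the index by compactness. *)
Lemma dot_grad_unif y v (eps : R) : 0 < eps ->
  \forall e \near 0^'+, forall s,
    dot (grad (phi ^~ s) (y + e *: v)) v <= dot (grad (phi ^~ s) y) v + eps.
Proof.
move=> eps0.
pose P (e : R) s := dot (grad (phi ^~ s) (y + e *: v)) v
  <= dot (grad (phi ^~ s) y) v + eps.
suff H : forall s, [set: T] s ->
    \forall s' \near s & e \near (0 : R)^'+, P e s'.
  move/compact_near_coveringP : cT => /(_ _ (0 : R)^'+ P _ H).
  by apply: filterS => e Pe s; exact: Pe.
move=> s _.
have cG : dot (grad (phi ^~ p.2) p.1) v @[p --> (y, s)] -->
    dot (grad (phi ^~ s) y) v.
  by apply: dot_cvg; [exact: (@cgrad (y, s))|exact: cvg_cst].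
have e20 : 0 < eps / 2 by rewrite divr_gt0.
have [[U V]/= [Uy Vs] UV] := @cvgr_dist_lt _ _ _ _ _ _ _ cG _ e20.
have cl : y + e *: v @[e --> (0 : R)^'+] --> y.
  have c0 : (fun e : R => y + e *: v) e @[e --> (0 : R)] --> y + (0 : R) *: v.
    apply: (@cvgD _ _ _ (nbhs (0 : R)) _ (fun _ => y) (fun e => e *: v)).
      exact: cvg_cst.
    by apply: cvgZr_tmp; exact: cvg_id.
  by apply: cvg_at_right_filter; rewrite scale0r addr0 in c0.
exists (V, [set e | U (y + e *: v)]); first by split => //; exact: cl.
move=> [s' e]/= [Vs' Ue]; rewrite /P.
have := UV (y + e *: v, s') (conj Ue Vs').
have := UV (y, s') (conj (nbhs_singleton Uy) Vs').
by rewrite /= !ltr_norml => /andP[? ?] /andP[? ?]; lra.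
Unshelve. all: by end_near. Qed.

Variable g : 'rV[R]_n -> \bar R.
Hypothesis gN : forall y, g y <> -oo%E.
Hypothesis cg : econvex g.

Lemma objective_fin y : (objective g phi y \is a fin_num) = (g y \is a fin_num).
Proof. by rewrite /objective; case: (g y). Qed.

Lemma objective_diffquot y v (e : R) : 0 < e -> g y \is a fin_num ->
  diffquot (objective g phi) y v e =
  (diffquot g y v e - diffquot (EFin \o maxfun phi) y v e)%E.
Proof.
move=> e0; rewrite /diffquot /objective /=; case: (g y) => // r _.
case: (g _) (@gN (y + e *: v)) => [a _|_|//].
  by rewrite -!EFinB -EFinM; congr EFin; ring.
by rewrite !addye// gt0_muley ?lte_fin ?invr_gt0// addye.
Qed.

(** Convexity at [y + e *: v] bounds [phi (y + e *: v) s] by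
    [phi y s + e * dot (grad (phi ^~ s) (y + e *: v)) v]; replacing the gradient
    by the one at [y] costs [e * eps] uniformly in [s], and the assumption
    bounds what results by [g (y + e *: v) - f y]. Taking the maximum over [s]
    gives [f (y + e *: v) - f y >= - e * eps]. This replaces a formula for the
    directional derivative of a maximum. *)
Lemma stationary_of_subgradients y : g y \is a fin_num ->
  (forall s z, (objective g phi y + (lin phi y s z)%:E <= g z)%E) ->
  dir_stationary g phi y.
Proof.
move=> gy sub; split; first by rewrite objective_fin.
move=> v.
have [b hb] := convex_real_dirderiv y v (maxfun_econvex cT cphi convphi).
have ha := @diffquot_cvg _ _ g y v cg gN gy.
set a := ereal_inf _ in ha.
have hab : is_dirderiv (objective g phi) y v (a - b%:E)%E.
  have : (diffquot g y v e - diffquot (EFin \o maxfun phi) y v e)%E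
      @[e --> (0 : R)^'+] --> (a - b%:E)%E.
    by apply: cvgeB => //; case: (a).
  apply: cvg_trans; apply: near_eq_cvg; near=> e.
  by rewrite -objective_diffquot//; near: e; exact: nbhs_right_gt.
exists a, b; split => //.
apply/lee_addgt0Pr => eps eps0; rewrite -leeBlDr// sub0e.
apply: (@cvge_ge _ _ _ _ _ _ _ _ hab).
near=> e.
have e0 : 0 < e by near: e; exact: nbhs_right_gt.
change (- eps%:E <= diffquot (objective g phi) y v e)%E.
have U : forall s,
    dot (grad (phi ^~ s) (y + e *: v)) v <= dot (grad (phi ^~ s) y) v + eps.
  by near: e; exact: dot_grad_unif.
rewrite /diffquot muleC lee_pdivlMr//.
move: sub gy; rewrite /objective; case: (g y) => // r sub _.
move: sub => /(_ _ (y + e *: v)).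
rewrite /lin; have -> : y + e *: v - y = e *: v by rewrite addrAC subrr add0r.
case: (g _) (@gN (y + e *: v)) => [c _|_|//] sub; last first.
  by rewrite -!EFinB !addye// leey.
rewrite -!EFinB -EFinM lee_fin.
suff : maxfun phi (y + e *: v) <= c - (r - maxfun phi y) + e * eps by lra.
apply: (maxfun_le) => s.
have := sub s; rewrite /lin -!EFinB -EFinD lee_fin => sub1.
have := @gradient_le _ _ (phi ^~ s) (y + e *: v) y (convphi s) (@dphi _ _).
have -> : y - (y + e *: v) = (- e) *: v.
  by rewrite opprD addrA subrr add0r scaleNr.
move: sub1 (U s); set w := grad _ _; set w' := grad _ _.
rewrite !dotZ => sub1 U1 G.
have : e * dot w' v <= e * (dot w v + eps) by rewrite ler_pM2l.
lra.
Unshelve. all: by end_near. Qed.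

End stationarity.

(** * Descent and limit points along one trajectory *)

Section descent.
Context {R : realType} {n : nat} {T : ptopologicalType}.
Variable phi : 'rV[R]_n -> T -> R.
Hypothesis cT : compact [set: T].
Hypothesis cphi : continuous (fun p : 'rV[R]_n * T => phi p.1 p.2).
Hypothesis convphi : forall s, convex_function [set: 'rV[R]_n] (phi ^~ s).
Hypothesis dphi : forall s y, differentiable (phi ^~ s) y.
Implicit Types (x y z v : 'rV[R]_n) (s t : T).
Variable g : 'rV[R]_n -> \bar R.
Hypothesis gN : forall y, g y <> -oo%E.

Lemma model_lin x s z : model g phi x s z = (g z - (lin phi x s z)%:E)%E.
Proof.
rewrite /model /lin; case: (g z) => [a| |]//.
by rewrite -!EFinB; congr EFin; ring.
Qed.

Lemma model_le x s y z : minimizer (subproblem g phi x s) y ->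
  (model g phi x s y <= model g phi x s z)%E.
Proof.
move=> /(_ z); rewrite /subproblem !model_lin /lin !dotB.
case: (g z) (@gN z) => [b _|_ _|//]; last by rewrite leey.
case: (g y) (@gN y) => [a _|_|//] //.
by rewrite -!EFinB !lee_fin => H; lra.
Qed.

(** The objective lies below each model, and the optimal model value for the
    chosen index [r0] is at most that for [r], hence at most the value of the
    model of [r] at an arbitrary [z]. *)
Lemma iteration_le x t s sol x' r z : iteration g phi x t s sol x' ->
  [set t; s] r -> (objective g phi x' <= g z - (lin phi x r z)%:E)%E.
Proof.
move=> [_ mt ms [r0 r0ts [min ->]]] rts.
have mr : minimizer (subproblem g phi x r) (sol r) by case: rts => ->.
rewrite -model_lin; apply: le_trans (model_le z mr).
apply: le_trans (min _ rts); rewrite model_lin /objective.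
apply: leeB => //; rewrite lee_fin.
apply: le_trans (le_maxfun cT cphi _ r0).
exact: (gradient_le _ (convphi r0)).
Qed.

(** The index [t] is active, so its linearization agrees with the maximum
    function at [x]; compare with the model of [t] at [z = x]. *)
Lemma iteration_descent x t s sol x' : iteration g phi x t s sol x' ->
  (objective g phi x' <= objective g phi x)%E.
Proof.
move=> it; have := @iteration_le _ _ _ _ _ t x it (or_introl erefl).
case: it => /= at_ _ _ _.
by rewrite /lin subrr dot0 addr0 at_.
Qed.

Hypothesis lscg : lower_semicontinuous g.

Lemma objective_lsc : lower_semicontinuous (objective g phi).
Proof.
move=> y c cy.
have [d d0 gd] : exists2 d : R, 0 < d & ((c + maxfun phi y + d)%:E < g y)%E.
  move: cy; rewrite /objective; case: (g y) (@gN y) => [r _|_|//].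
  - rewrite -EFinB lte_fin => cr.
    exists ((r - maxfun phi y - c) / 2); first lra.
    by rewrite lte_fin; lra.
  - by exists 1 => //; rewrite ltry.
have [V Vy gV] := lscg gd.
have hV : \forall z \near y, maxfun phi z <= maxfun phi y + d.
  by apply: maxfun_usc => //; rewrite ltrDl.
exists (V `&` [set z | maxfun phi z <= maxfun phi y + d]); first exact: filterI.
move=> z [Vz /= hz]; have := gV _ Vz; rewrite /objective.
case: (g z) (@gN z) => [r _|_ _|//]; last by rewrite ltry.
by rewrite -EFinB !lte_fin; lra.
Qed.

Hypothesis cgrad : continuous (fun p : 'rV[R]_n * T => grad (phi ^~ p.2) p.1).

Lemma lin_continuous z : continuous (fun p : 'rV[R]_n * T => lin phi p.1 p.2 z).
Proof.
move=> p; apply: (@cvgD _ _ _ _ _ (fun p => phi p.1 p.2)); first exact: cphi.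
apply: dot_cvg; first exact: cgrad.
apply: (@cvgB _ _ _ _ _ (fun=> z)); first exact: cvg_cst.
exact: cvg_fst.
Qed.

Hypothesis finf : ereal_inf (range (objective g phi)) \is a fin_num.

(** Each visit near [y] with an index near [s] gives
    [f (x k.+1) <= g z - lin phi y s z] up to a small error, and [f (x k.+1)]
    is at least the infimum of [f] along the sequence. This infimum is at least
    [f y]: by descent, a smaller value at one step would persist at all later
    steps, against lower semicontinuity at the limit point [y]. *)
Lemma limit_subgradient (x : nat -> 'rV[R]_n) (xi : nat -> T) y :
  (forall k z,
    (objective g phi (x k.+1) <= g z - (lin phi (x k) (xi k) z)%:E)%E) ->
  (forall k, (objective g phi (x k.+1) <= objective g phi (x k))%E) ->
  cluster (x @ \oo) y ->
  (forall s U V, nbhs y U -> nbhs s V -> exists k, U (x k) /\ V (xi k)) ->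
  g y \is a fin_num /\
  forall s z, (objective g phi y + (lin phi y s z)%:E <= g z)%E.
Proof.
move=> step dec clu rec.
pose f := objective g phi; pose m := ereal_inf (range (f \o x)).
have flow z : (-oo < f z)%E.
  have : (ereal_inf (range f) <= f z)%E by apply: ereal_inf_lbound; exists z.
  by apply: lt_le_trans; move: finf; rewrite fin_numElt => /andP[].
have [z0 [c0 gz0]] : exists z0 c0, g z0 = c0%:E.
  apply: contrapT => H.
  have gy z : g z = +oo%E.
    case E : (g z) (@gN z) => [c||] // _.
    by exfalso; apply: H; exists z, c.
  suff E : ereal_inf (range f) = +oo%E by move: finf; rewrite E.
  by apply/ereal_inf_pinfty => _ [z _ <-]; rewrite /f /objective gy.
(* f (x 0) may be +oo, but f is finite from the first step on. *)
have f1 : (f (x 1%N) < +oo)%E.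
  by apply: le_lt_trans (step 0%N z0) _; rewrite gz0 -EFinB ltry.
have mk k : (m <= f (x k))%E by apply: ereal_inf_lbound; exists k.
have fdec j k : (j <= k)%N -> (f (x k) <= f (x j))%E.
  elim: k => [|k IH]; first by rewrite leqn0 => /eqP ->.
  by rewrite leq_eqVlt => /predU1P[->//|/IH]; apply: le_trans; exact: dec.
have fym : (f y <= m)%E.
  apply: le_ereal_inf_tmp => _ [k _ <-]; rewrite leNgt /=; apply/negP => ky.
  case E : (f (x k)) (flow (x k)) ky => [c||]// _ cy; last first.
    by move: cy; rewrite ltNge leey.
  have [V Vy HV] := objective_lsc cy.
  have A : (x @ \oo) (x @` [set j | (k <= j)%N]).
    by exists k => // j /= kj; exists j.
  have [_ [[j /= kj <-] /HV]] := clu _ _ A Vy.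
  by rewrite ltNge -E fdec.
have fyoo : (f y < +oo)%E.
  by apply: le_lt_trans fym _; apply: le_lt_trans f1; exact: mk.
split.
  move: fyoo; rewrite -(objective_fin phi) fin_numElt => ->.
  by rewrite andbT; exact: flow.
move=> s z; case gz : (g z) (@gN z) => [c||]// _; last by rewrite leey.
apply: le_trans (leeD2r _ fym) _.
apply/lee_addgt0Pr => e e0.
have [[U V]/= [Uy Vs] UV] : \forall p \near (y, s),
    lin phi y s z - e < lin phi p.1 p.2 z.
  have /cvgr_gt := @lin_continuous z (y, s); apply; lra.
have [k [Uk Vk]] := rec s U V Uy Vs.
have := UV (x k, xi k) (conj Uk Vk) => /= lk.
apply: le_trans (leeD2r _ (le_trans (mk k.+1) (step k z))) _.
by rewrite gz -EFinB -!EFinD lee_fin; lra.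
Qed.

End descent.

(** * A conditional Borel-Cantelli lemma *)

Section conditional_Borel_Cantelli.
Context {d : measure_display} {Omega : measurableType d} {R : realType}.
Variable Q : probability Omega R.
Variable H : nat -> set (set Omega).
Hypothesis sH : forall k, sigma_algebra setT (H k).
Hypothesis mH : forall k, H k `<=` measurable.
Hypothesis incH : forall k, H k `<=` H k.+1.
Variables A B : nat -> set Omega.
Hypothesis HA : forall k, H k (A k).
Hypothesis HB : forall k, H k.+1 (B k).
Variable q : R.
Hypothesis q0 : 0 <= q.
Hypothesis q1 : q < 1.
Hypothesis missq : forall k D, H k D -> (Q (D `&` ~` B k) <= q%:E * Q D)%E.

Lemma sigma_algebraI k : setI_closed (H k).
Proof.
by rewrite -(measurable_g_measurableTypeE (sH k)) => X Y; exact: measurableI.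
Qed.

Lemma sigma_algebraC k X : H k X -> H k (~` X).
Proof. by case: (sH k) => _ + _ => /[apply]; rewrite setTD. Qed.

(** The first [j] occurrences of [A] from time [m] on fall within the [l] steps
    from [m], and [B] fails at each of them. The recursion looks at time [m]
    first so that independence applies to the earliest trial, whose occurrence
    is decided by the past. *)
Fixpoint misses l j m : set Omega :=
  match l, j with
  | _, 0 => setT
  | 0, _.+1 => set0
  | l'.+1, j'.+1 => (~` A m `&` misses l' j m.+1) `|`
                    (A m `&` ~` B m `&` misses l' j' m.+1)
  end%N.

Lemma measurable_misses l j m : measurable (misses l j m).
Proof.
elim: l j m => [|l IH] [|j] m //=.
have mA := mH (HA m); have mB := mH (HB m).
apply: measurableU; apply: measurableI; try exact: IH; first exact: measurableC.
by apply: measurableI => //; exact: measurableC.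
Qed.

Lemma misses_mono l j m : misses l j m `<=` misses l.+1 j m.
Proof.
elim: l j m => [|l IH] [|j] m //.
move=> w [[nA /IH]|[nAB /IH]] h; [left|right]; split => //.
Qed.

(** If [A m] fails, move on to time [m.+1]; if it occurs, a missed trial costs
    a factor [q]. The past event [D] absorbs what has been observed. *)
Lemma misses_le l j m D : H m D ->
  (Q (D `&` misses l j m) <= (q ^+ j)%:E * Q D)%E.
Proof.
elim: l j m D => [|l IH] [|j] m D HD /=; rewrite ?setIT ?expr0 ?mul1e//.
  by rewrite setI0 measure0 mule_ge0// lee_fin exprn_ge0.
have HD1 : H m (D `&` ~` A m).
  by apply: sigma_algebraI => //; exact: sigma_algebraC.
have HD2 : H m (D `&` A m) by exact: sigma_algebraI.
have HD3 : H m.+1 (D `&` A m `&` ~` B m).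
  by apply: sigma_algebraI; [exact: incH|exact: sigma_algebraC].
rewrite setIUr !setIA.
apply: le_trans (measureU2 _ _ _) _.
- apply: measurableI; [exact: mH HD1|exact: measurable_misses].
- apply: measurableI; [exact: mH HD3|exact: measurable_misses].
apply: le_trans (leeD (IH _ _ _ (incH HD1)) (IH _ _ _ HD3)) _.
have -> : Q D = (Q (D `&` ~` A m) + Q (D `&` A m))%E.
  by rewrite (measureDI Q (mH HD) (mH (HA m))) setDE.
rewrite ge0_muleDr//; apply: leeD => //.
rewrite exprSr EFinM -muleA.
by apply: lee_wpmul2l; [rewrite lee_fin exprn_ge0|exact: missq].
Qed.

Lemma misses_cover w j m : (forall N, exists2 k, (N <= k)%N & A k w) ->
  (forall k, A k w -> ~ B k w) -> exists l, misses l j m w.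
Proof.
move=> io ms; elim: j m => [|j IHj] m; first by exists 0%N.
have [k mk] := io m; rewrite -(subnKC mk); move: (k - m)%N => e {k mk}.
elim: e m => [|e IHe] m.
  rewrite addn0 => Am; have [l hl] := IHj m.+1.
  by exists l.+1; right; split => //; split => //; exact: ms.
case: (pselect (A m w)) => [Am _|Am].
  have [l hl] := IHj m.+1.
  by exists l.+1; right; split => //; split => //; exact: ms.
rewrite -addSnnS => /IHe[l hl].
by exists l.+1; left.
Qed.

(** Trials performed infinitely often, each succeeding with conditional
    probability at least [1 - q], almost surely do not all fail:
    the first [j] of them fail with probability at most [q ^+ j]. *)
Lemma conditional_Borel_Cantelli : Q.-negligible
  [set w | (forall N, exists2 k, (N <= k)%N & A k w) /\
           forall k, A k w -> ~ B k w].
Proof.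
pose M j := \bigcup_l misses l j 0.
have mM j : measurable (M j).
  by apply: bigcup_measurable => l _; exact: measurable_misses.
have QM j : (Q (M j) <= (q ^+ j)%:E)%E.
  have cM : Q (misses l j 0) @[l --> \oo] --> Q (M j).
    apply: nondecreasing_cvg_mu; [|exact: mM|].
      by move=> l; exact: measurable_misses.
    apply/nondecreasing_seqP => l; apply/subsetPset; exact: misses_mono.
  apply: cvge_le cM; apply: nearW => l.
  have HT : H 0%N setT.
    by rewrite -setC0; apply: sigma_algebraC; case: (sH 0).
  have := misses_le l j HT.
  by rewrite setTI probability_setT mule1.
have mI : measurable (\bigcap_j M j) by exact: bigcap_measurable.
exists (\bigcap_j M j); split => //; last first.
  move=> w [io ms] j _; have [l hl] := misses_cover j 0 io ms.
  by exists l.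
apply/eqP; rewrite eq_le measure_ge0 andbT.
have c0 : (q ^+ j)%:E @[j --> \oo] --> 0%:E.
  by apply: cvg_EFin; [exact: nearW|apply: cvg_expr; rewrite ger0_norm].
apply: cvge_ge c0; apply: nearW => j; apply: le_trans (QM j).
by apply: le_measure; rewrite ?inE//; exact: bigcap_inf.
Qed.

End conditional_Borel_Cantelli.

(** * Countable families of balls *)

Lemma metric_ball_open {R : realFieldType} (T : metricType R) (x : T) (r : R) :
  open (ball x r).
Proof.
rewrite openE => y; rewrite ballEmdist /= => xy.
apply/nbhs_ballP; exists (r - mdist x y) => /=; first by rewrite subr_gt0.
move=> z; rewrite ballEmdist /= ltrBrDl.
exact/le_lt_trans/metric_triangle.
Qed.

Lemma compact_countable_net {R : realType} (T : pmetricType R) :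
  compact [set: T] -> exists c : nat -> nat -> T,
    forall j t, exists i, ball (c j i) j.+1%:R^-1 t.
Proof.
rewrite compact_cover => cT.
have net j : exists s : seq T,
    forall t, exists i, ball (nth point s i) j.+1%:R^-1 t.
  have [||D _ cov] := cT T [set: T] (fun s => ball s j.+1%:R^-1).
  - by move=> s _; exact: metric_ball_open.
  - by move=> t _; exists t => //; apply: ballxx; rewrite invr_gt0.
  exists (finmap.enum_fset D) => t; have [s sD st] := cov t I.
  by exists (index s (finmap.enum_fset D)); rewrite nth_index.
have [s hs] := choice net.
by exists (fun j i => nth point (s j) i).
Qed.

Lemma rat_rV_dense {R : realType} {n : nat} (y : 'rV[R]_n) (e : R) : 0 < e ->
  exists r : 'rV[rat]_n, ball (map_mx ratr r : 'rV[R]_n) e y.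
Proof.
move=> e0.
have rd i : exists r : rat, ball (ratr r : R) e (y 0 i).
  have [|r] := @rat_in_itvoo R (y 0 i - e) (y 0 i + e); first lra.
  rewrite in_itv /= => /andP[r1 r2]; exists r.
  by rewrite /ball /= ltr_norml; apply/andP; split; lra.
have [r hr] := choice rd.
exists (\row_i r i); split => // i j; rewrite !mxE (ord1 i); exact: hr.
Qed.

Lemma double_inv_lt {R : realType} (e : R) : 0 < e ->
  exists j, j.+1%:R^-1 + j.+1%:R^-1 < e.
Proof.
move=> e0; have [j] := @ltr_add_invr R 0 (e / 2) ltac:(by rewrite divr_gt0).
by rewrite add0r => h; exists j; rewrite [e]splitr; exact: ltrD.
Qed.

Lemma ball_sub_ball {R : realType} {M : pseudoMetricType R} (a b : M)
    (e h : R) :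
  h + h < e -> ball a h b -> ball a h `<=` ball b e.
Proof.
move=> he ab z az; apply: le_ball (ltW he) _ _.
exact: ball_triangle (ball_sym ab) az.
Qed.

(** * Recurrence of the pairs formed by the iterate and the random index *)

Section run.
Context {R : realType} {n : nat} {T : pmetricType R} {d : measure_display}
  {Omega : measurableType d}.
Variables (P : probability (borel T) R) (Q : probability Omega R).
Variables (x : nat -> Omega -> 'rV[R]_n) (xi : nat -> Omega -> T).
Hypothesis Ppos : forall (s : T) (e : R), 0 < e -> (0 < P (ball s e))%E.
Hypothesis mx : forall k, measurable_fun setT (x k : Omega -> borel 'rV[R]_n).
Hypothesis mxi : forall k, measurable_fun setT (xi k : Omega -> borel T).
Hypothesis xiP : forall k (B : set (borel T)), measurable B ->
    Q (xi k @^-1` B) = P B.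
Hypothesis ind : forall k (A : set Omega) (B : set (borel T)),
    history x xi k A -> measurable B ->
    Q (A `&` xi k @^-1` B) = (Q A * Q (xi k @^-1` B))%E.

Lemma open_borel {M : ptopologicalType} (U : set M) : open U ->
  measurable (U : set (borel M)).
Proof. by move=> oU; exact: sub_sigma_algebra. Qed.

Lemma history_sigma k : sigma_algebra setT (history x xi k).
Proof. exact: smallest_sigma_algebra. Qed.

Lemma history_measurable k : history x xi k `<=` measurable.
Proof.
apply: smallest_sub; first exact: sigma_algebra_measurable.
move=> A [[j _]|[j _]] [B mB <-].
  exact: mx.
exact: mxi.
Qed.

Lemma history_incr k : history x xi k `<=` history x xi k.+1.
Proof.
apply: sub_sigma_algebra2 => A [[j jk ?]|[j jk ?]]; [left|right].
  by exists j => //; exact: leqW.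
by exists j => //; exact: leqW.
Qed.

Lemma open_ball_recurrence (U : set 'rV[R]_n) (s : T) (e : R) :
  open U -> 0 < e ->
  {ae Q, forall w, (forall N, exists2 k, (N <= k)%N & U (x k w)) ->
    exists k, U (x k w) /\ ball s e (xi k w)}.
Proof.
move=> oU e0.
have mV : measurable (ball s e : set (borel T)).
  by apply: open_borel; exact: metric_ball_open.
have fP : P (ball s e) \is a fin_num by exact: fin_num_measure.
pose p := fine (P (ball s e)).
have p0 : 0 < p by rewrite fine_gt0// Ppos//= -ge0_fin_numE.
have p1 : p <= 1 by rewrite -lee_fin fineK// probability_le1.
have := @conditional_Borel_Cantelli _ _ _ Q (history x xi)
  history_sigma history_measurable history_incr
  (fun k => x k @^-1` U) (fun k => xi k @^-1` ball s e) _ _ (1 - p) _ _ _.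
case.
- move=> k; apply: sub_sigma_algebra; left; exists k => //.
  by exists U; [exact: open_borel|rewrite setTI].
- move=> k; apply: sub_sigma_algebra; right; exists k => //.
  by exists (ball s e) => //; rewrite setTI.
- lra.
- lra.
- move=> k D HD; rewrite preimage_setC.
  have mC : measurable (~` ball s e : set (borel T)) by exact: measurableC.
  rewrite ind// xiP// probability_setC// muleC EFinB fineK//.
move=> N [mN N0 sub]; exists N; split => //.
move=> w /= nw; apply: sub; split.
  by apply: contrapT => nio; apply: nw => io; exfalso; apply: nio.
move=> k Uk Bk; apply: nw => _; exists k; split => //.
Qed.

Hypothesis cT : compact [set: T].

(** Cluster points and the indices to be approached depend on the outcome, so
    the exceptional null sets have to be chosen beforehand: countably many
    balls in both factors suffice, with rational centers in the first and
    centers in finite nets in the second. *)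
Lemma ae_recurrence : {ae Q, forall w (y : 'rV[R]_n),
  cluster (x ^~ w @ \oo) y ->
  forall (s : T) (U : set 'rV[R]_n) (V : set T), nbhs y U -> nbhs s V ->
  exists k, U (x k w) /\ V (xi k w)}.
Proof.
have [c hc] := compact_countable_net cT.
pose G w (a : 'rV[rat]_n * nat * nat * nat) :=
  let: (r, i, j, l) := a in
  let U := ball (map_mx ratr r : 'rV[R]_n) i.+1%:R^-1 in
  (forall N, exists2 k, (N <= k)%N & U (x k w)) ->
  exists k, U (x k w) /\ ball (c j l) j.+1%:R^-1 (xi k w).
have aeG : {ae Q, forall w, forall N : nat,
    if unpickle N is Some a then G w a else True}.
  apply/ae_foralln => N.
  case: (unpickle N) => [[[[r i] j] l]|]; last exact: aeW.
  by apply: open_ball_recurrence; [exact: ball_open|rewrite invr_gt0].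
apply: filterS aeG => w Gw y cy s U V.
move=> /nbhs_ballP[e /= e0 eU] /nbhs_ballP[h /= h0 hV].
have [i ie] := double_inv_lt e0; have [j jh] := double_inv_lt h0.
have i0 : 0 < i.+1%:R^-1 :> R by rewrite invr_gt0.
have [r ry] := rat_rV_dense y i0.
have [l ls] := hc j s.
have := Gw (pickle (r, i, j, l)); rewrite pickleK /= => -[].
  move=> N.
  have XN : (x ^~ w @ \oo) (x ^~ w @` [set k | (N <= k)%N]).
    by exists N => // k /= Nk; exists k.
  have [_ [[k Nk <-] kB]] :=
    cy _ _ XN (open_nbhs_nbhs (conj (ball_open _ _) ry)).
  by exists k.
move=> k [Uk Vk]; exists k; split.
  by apply: eU; exact: ball_sub_ball ie ry _ Uk.
by apply: hV; exact: ball_sub_ball jh ls _ Vk.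
Qed.

End run.

(** * The theorem *)

Theorem theorem4p2 (R : realType) (n : nat) (T : pmetricType R)
    (P : probability (borel T) R)
    (phi : 'rV[R]_n -> T -> R) (g : 'rV[R]_n -> \bar R)
    (d : measure_display) (Omega : measurableType d)
    (Q : probability Omega R) (x0 : 'rV[R]_n)
    (x : nat -> Omega -> 'rV[R]_n) (t xi : nat -> Omega -> T)
    (sol : nat -> Omega -> T -> 'rV[R]_n) :
  compact [set: T] ->
  (forall (s : T) (e : R), 0 < e -> (0 < P (ball s e))%E) ->
  continuous (fun p : 'rV[R]_n * T => phi p.1 p.2) ->
  (forall s : T, convex_function [set: 'rV[R]_n] (phi ^~ s)) ->
  (forall (s : T) (y : 'rV[R]_n), differentiable (phi ^~ s) y) ->
  continuous (fun p : 'rV[R]_n * T => grad (phi ^~ p.2) p.1) ->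
  (forall y, g y <> -oo%E) ->
  lower_semicontinuous g ->
  econvex g ->
  ereal_inf (range (objective g phi)) \is a fin_num ->
  randomized_run g phi P Q x0 x t xi sol ->
  {ae Q, forall w, bounded_set (range (fun k => x k w))} ->
  (forall w k, (objective g phi (x k.+1 w) <= objective g phi (x k w))%E) /\
  {ae Q, forall w, forall y : 'rV[R]_n,
    cluster ((fun k => x k w) @ \oo) y -> dir_stationary g phi y}.
Proof.
move=> cT Ppos cphi convphi dphi cgrad gN lscg cg finf run _.
have dec w k : (objective g phi (x k.+1 w) <= objective g phi (x k w))%E.
  have it := run_iteration run k w.
  exact (iteration_descent cT cphi convphi dphi gN it).
split => //.
have rec := ae_recurrence Ppos (run_measurable_x run) (run_measurable_xi run)
  (run_distribution run) (run_independence run) cT.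
apply: filterS rec => w rec y cy.
have [gy sub] : g y \is a fin_num /\
    forall s z, (objective g phi y + (lin phi y s z)%:E <= g z)%E.
  apply: (@limit_subgradient _ _ _ phi cT cphi g gN lscg cgrad finf
    (x ^~ w) (xi ^~ w)) => //.
  - move=> k z; have it := run_iteration run k w.
    exact (iteration_le cT cphi convphi dphi gN z it (or_intror erefl)).
  - exact: rec.
exact: stationary_of_subgradients.
Qed.
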